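(* Let $\mathcal X$ be an ordered topological vector space admitting a strictly positive element $U\in\mathcal X_+$. Let $\mathcal A\subset\mathcal X$ be a convex acceptance set with nonempty interior, and $S=(S_0,S_T)$ a traded asset. Assume $\rho_{\mathcal A,S}$ does not attain the value $-\infty$. Then $\rho_{\mathcal A,S}$ is finitely valued if and only if $\rho_{\mathcal A,S}(-\lambda U)<\infty$ for all $\lambda>0$. In this case, $\rho_{\mathcal A,S}$ is also continuous.
   Context: An ordered topological vector space $\mathcal X$ is a Hausdorff real topological vector space ordered by a pointed convex cone $\mathcal X_+$ ($\mathcal X_+\cap(-\mathcal X_+)=\{0\}$); $X\le Y$ means $Y-X\in\mathcal X_+$. $\mathcal X'$ is the topological dual and $\mathcal X'_+=\{\psi\in\mathcal X' : \psi(X)\ge0 \text{ for all } X\in\mathcal X_+\}$. An element $U\in\mathcal X_+$ is strictly positive if $\psi(U)>0$ for all nonzero $\psi\in\mathcal X'_+$. An acceptance set is a nonempty proper subset $\mathcal A\subset\mathcal X$ such that $X\in\mathcal A$ and $Y\ge X$ imply $Y\in\mathcal A$. A traded asset is a pair $S=(S_0,S_T)$ with $S_0>0$ a real number and $S_T\in\mathcal X_+$ nonzero. The associated risk measure $\rho_{\mathcal A,S}:\mathcal X\to\mathbb R\cup\{\pm\infty\}$ is $$\rho_{\mathcal A,S}(X)=\inf\{m\in\mathbb R : X+\tfrac{m}{S_0}S_T\in\mathcal A\},$$ with $\inf\emptyset=\infty$. *)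

(* Defs.v *)
From HB Require Import structures.
From mathcomp Require Import all_boot all_order all_algebra.
From mathcomp Require Import all_classical all_reals all_analysis.

Set Implicit Arguments.
Unset Strict Implicit.
Unset Printing Implicit Defensive.

Import Order.TTheory GRing.Theory Num.Theory.
Import numFieldNormedType.Exports.

Local Open Scope classical_set_scope.
Local Open Scope ring_scope.

(* [topologicalLmodType R] is used for topological vector spaces rather than
   [tvsType R], since the latter also imposes local convexity. *)

Definition convex_cone (R : realType) (X : lmodType R) (P : set X) : Prop :=
  [/\ P !=set0, convex_set P & forall (a : R) x, 0 <= a -> P x -> P (a *: x)].

Definition pointed_convex_cone (R : realType) (X : lmodType R) (P : set X) :
    Prop :=
  convex_cone P /\ P `&` [set - x | x in P] = [set 0].

Definition ordered_tvs (R : realType) (X : topologicalLmodType R) (P : set X) :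
    Prop :=
  hausdorff_space X /\ pointed_convex_cone P.

Definition cone_le (R : realType) (X : lmodType R) (P : set X) (x y : X) :
    Prop :=
  P (y - x).

Definition topological_dual (R : realType) (X : topologicalLmodType R) :
    set {linear X -> R^o} :=
  [set psi | continuous psi].

Definition dual_cone (R : realType) (X : topologicalLmodType R) (P : set X) :
    set {linear X -> R^o} :=
  [set psi | topological_dual psi /\ forall x, P x -> 0 <= (psi x : R)].

Definition strictly_positive (R : realType) (X : topologicalLmodType R)
    (P : set X) (U : X) : Prop :=
  P U /\ forall psi : {linear X -> R^o}, dual_cone P psi ->
    (psi : X -> R) <> cst 0 -> 0 < (psi U : R).

Definition acceptance_set (R : realType) (X : lmodType R) (P A : set X) :
    Prop :=
  [/\ A !=set0, A <> setT & forall x y, A x -> cone_le P x y -> A y].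

(* [S.1] is the price $S_0$ and [S.2] the payoff $S_T$. *)
Definition traded_asset (R : realType) (X : lmodType R) (P : set X)
    (S : R * X) : Prop :=
  [/\ 0 < S.1, P S.2 & S.2 <> 0].

Definition risk_measure (R : realType) (X : lmodType R) (A : set X)
    (S : R * X) (x : X) : \bar R :=
  ereal_inf [set m%:E | m in [set m : R | A (x + (m / S.1) *: S.2)]].

Definition finitely_valued (R : realType) (T : Type) (f : T -> \bar R) : Prop :=
  forall x, f x \is a fin_num.

(* Main.v *)
(* If the effective domain D = A + R S_T of the risk measure missed a point x0,
   Hahn-Banach would give a continuous psi <> 0 with psi x0 <= psi on D. As
   D + X_+ is contained in D, psi is positive, hence psi U > 0; but D contains
   every - lambda U, and psi (- lambda U) tends to -oo, a contradiction. The
   continuity is that of a convex function bounded above on an open set.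

   The separation theorem is obtained without a gauge: Zorn's lemma enlarges the
   cone generated by D - x0 to the strictly positive part of a total vector
   space order, in which u = d0 - x0 (d0 interior to D) is an order unit, and
   psi v = sup {r | r u < v} is linear. *)

Require Import Defs.
From HB Require Import structures.
From mathcomp Require Import all_boot all_order all_algebra ring lra.
From mathcomp Require Import all_classical all_reals all_analysis.

Set Implicit Arguments.
Unset Strict Implicit.
Unset Printing Implicit Defensive.

Import Order.TTheory GRing.Theory Num.Theory.
Import numFieldNormedType.Exports.

Local Open Scope classical_set_scope.
Local Open Scope ring_scope.

Lemma convex_set_combination (R : realType) (X : lmodType R) (D : set X)
    (t : R) (x y : X) : convex_set D -> 0 <= t <= 1 -> D x -> D y ->
  D (t *: x + (1 - t) *: y).
Proof.
move=> cD /andP[t0 t1] Dx Dy.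
by have /set_mem := cD x y (Itv01 t0 t1) (mem_set Dx) (mem_set Dy).
Qed.

Lemma convex_function_combination (R : realType) (X : lmodType R)
    (f : X -> R^o) (t : R) (x y : X) :
  convex_function [set: X] f -> 0 <= t <= 1 ->
  f (t *: x + (1 - t) *: y) <= t * f x + (1 - t) * f y.
Proof.
move=> cf /andP[t0 t1].
exact: (cf (Itv01 t0 t1) x y (mem_set I) (mem_set I)).
Qed.

(** * Extension of vector space orders to total ones *)

Definition blunt_convex_cone (R : realType) (X : lmodType R) (C : set X) :=
  [/\ forall x y, C x -> C y -> C (x + y),
      forall (a : R) x, 0 < a -> C x -> C (a *: x) &
      ~ C 0].

(** A blunt cone is the strictly positive part of a vector space order, [~ C 0] being irreflexivity.
    Maximality forces totality: if neither [v <> 0] nor [- v] lies in the cone, adjoining [v] gives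
    a larger blunt one, since [0 = c + t *: v] would put [- v = t^-1 *: c] in the old cone. *)
Lemma blunt_convex_cone_total (R : realType) (X : lmodType R) (C0 : set X) :
  blunt_convex_cone C0 ->
  exists C : set X, [/\ C0 `<=` C, blunt_convex_cone C &
    forall v, v <> 0 -> C v \/ C (- v)].
Proof.
move=> [add0 scale0 C00].
(* Zorn is applied to sets B completing C0, since [Zorn_bigcup] also takes
   the union of the empty chain, which need not contain C0. *)
pose P (B : set X) := blunt_convex_cone (B `|` C0).
have [F FP totF|B [[addB scaleB B0] maxB]] := @Zorn_bigcup X P.
  split=> [x y|a x a0|[[B FB B0]|/C00//]]; last first.
    by have [_ _] := FP B FB; apply; left.
  - move=> [[B FB Bx]|C0x]; last by right; exact: scale0.
    have [_ /(_ a x a0 (or_introl Bx)) [Bax|C0ax] _] := FP B FB; last by right.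
    by left; exists B.
  - have main B : F B -> (B `|` C0) x -> (B `|` C0) y ->
        (\bigcup_(B in F) B `|` C0) (x + y).
      move=> FB Bx By; have [/(_ x y Bx By) [Bxy|C0xy] _ _] := FP B FB.
        by left; exists B.
      by right.
    move=> [[B FB Bx]|C0x] [[B' FB' By]|C0y].
    + have [BB'|B'B] := totF B B' FB FB'.
        by apply: (main B' FB'); left => //; exact: BB'.
      by apply: (main B FB); left => //; exact: B'B.
    + by apply: (main B FB); [left|right].
    + by apply: (main B' FB'); [right|left].
    + by right; exact: add0.
exists (B `|` C0); split=> //.
move=> v v0; apply: contrapT => /not_orP[nCv nCNv].
(* The case [c = 0] is listed apart because the old cone omits 0; it is what puts [v] itself in
   [B']. *)
pose B' := B `|` [set w | exists2 t : R, 0 < t &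
  exists2 c, (B `|` C0) c \/ c = 0 & w = c + t *: v].
have sub : B `<` B'.
  split; first by left.
  move=> /(_ v) B'B; apply: nCv; left; apply: B'B; right.
  by exists 1 => //; exists 0; [right|rewrite add0r scale1r].
apply: (maxB _ sub).
have B'E w : (B' `|` C0) w <-> (B `|` C0) w \/ exists2 t : R, 0 < t &
    exists2 c, (B `|` C0) c \/ c = 0 & w = c + t *: v.
  by rewrite /B' /setU /=; tauto.
have addc c d : (B `|` C0) c \/ c = 0 -> (B `|` C0) d \/ d = 0 ->
    (B `|` C0) (c + d) \/ c + d = 0.
  move=> [Bc|->]; last by rewrite add0r.
  by move=> [Bd|->]; [left; exact: addB|rewrite addr0; left].
split.
- move=> x y /B'E[Bx|[t t0 [c Cc ->]]] /B'E[By|[s s0 [d Cd ->]]]; apply/B'E.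
  + by left; exact: addB.
  + right; exists s => //; exists (x + d); last by rewrite addrA.
    by apply: addc => //; left.
  + right; exists t => //; exists (c + y); last by rewrite addrAC.
    by apply: addc => //; left.
  + right; exists (t + s); first exact: addr_gt0.
    by exists (c + d); [exact: addc|rewrite scalerDl addrACA].
- move=> a x a0 /B'E[Bx|[t t0 [c Cc ->]]]; apply/B'E.
    by left; exact: scaleB.
  right; exists (a * t); first exact: mulr_gt0.
  exists (a *: c); last by rewrite scalerDr scalerA.
  by case: Cc => [Cc|->]; [left; exact: scaleB|right; rewrite scaler0].
- move=> /B'E[//|[t t0 [c [Cc|->]]]].
    move/esym/eqP; rewrite addr_eq0 => /eqP cE; apply: nCNv.
    have -> : - v = t^-1 *: c.
      by rewrite cE scalerN scalerA mulVf ?scale1r// gt_eqF.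
    by apply: scaleB => //; rewrite invr_gt0.
  move/esym/eqP; rewrite add0r scaler_eq0 gt_eqF//= => /eqP.
  exact: v0.
Qed.

(** Reading [C (w - v)] as [v < w], totality makes the lower and upper cuts of [v] among the
    multiples of [u] meet at [psi v]. So [v] lies between [(psi v - e) *: u] and [(psi v + e) *: u]
    for all [e > 0]; adding and scaling such bounds gives linearity. *)
Lemma total_cone_functional (R : realType) (X : lmodType R) (C : set X)
    (u : X) :
  blunt_convex_cone C -> (forall v, v <> 0 -> C v \/ C (- v)) ->
  C u -> (forall v, exists r : R, C (r *: u - v)) ->
  exists psi : {linear X -> R^o},
    psi u = 1 /\ forall v, C v -> 0 <= (psi v : R).
Proof.
move=> [addC scaleC nC0] totC Cu unitC.
pose E v := [set r : R | C (v - r *: u)].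
pose psi v := sup (E v).
(* Here [(s - r) *: u] is in the cone; if [s <= r], adding [(r - s) *: u] would yield 0. *)
have lt_of r s v : C (v - r *: u) -> C (s *: u - v) -> r < s.
  move=> /addC/[apply]; rewrite addrC subrKA -scalerBl => Crs.
  rewrite -subr_gt0 ltNge; apply/negP; rewrite le_eqVlt => /predU1P[sr0|sr0].
    by apply: nC0; rewrite sr0 scale0r in Crs.
  apply: nC0; rewrite -(scale0r u) -(subrr (s - r)) scalerBl -scaleNr opprB.
  by apply: addC => //; apply: scaleC => //; rewrite -opprB oppr_gt0.
have supE v : has_sup (E v).
  split.
    have [r Cr] := unitC (- v); exists (- r).
    by rewrite /E /= scaleNr opprK addrC -[v]opprK.
  by have [s Cs] := unitC v; exists s => r Er; exact/ltW/(lt_of _ _ v).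
have psi_ge r v : C (v - r *: u) -> r <= psi v.
  by move=> Cr; exact: ub_le_sup (supE v).2 _ Cr.
have psi_le r v : C (r *: u - v) -> psi v <= r.
  by move=> Cr; apply: ge_sup (supE v).1 _ => s Es; exact/ltW/(lt_of _ _ v).
have psi_gt r v : r < psi v -> C (v - r *: u).
  move=> /(sup_gt (supE v).1)[s Es rs].
  rewrite -(subrK (s *: u) v) -addrA -scalerBl; apply: addC => //.
  by apply: scaleC; rewrite ?subr_gt0.
have psi_lt r v : psi v < r -> C (r *: u - v).
  move=> vr; have [vE|/eqP/totC[]] := eqVneq (v - r *: u) 0.
  - have := psi_ge ((psi v + r) / 2) v; rewrite -{1}(subrK (r *: u) v) vE add0r.
    rewrite -scalerBl => /(_ (scaleC _ _ _ Cu)); lra.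
  - by move=> /psi_ge; rewrite leNgt vr.
  - by rewrite opprB.
have psiD v w : psi (v + w) = psi v + psi w.
  apply/eqP; rewrite eq_le; apply/andP; split; apply/ler_addgt0Pl => e e0.
    apply: psi_le; have -> : (e + (psi v + psi w)) *: u - (v + w) =
        ((psi v + e / 2) *: u - v) + ((psi w + e / 2) *: u - w).
      rewrite addrACA -scalerDl opprD; congr (_ *: _ + _); lra.
    by apply: addC; apply: psi_lt; lra.
  rewrite -lerBlDl; apply: psi_ge.
  have -> : (v + w) - (psi v + psi w - e) *: u =
      (v - (psi v - e / 2) *: u) + (w - (psi w - e / 2) *: u).
    rewrite addrACA -opprD -scalerDl; congr (_ - _ *: _); lra.
  by apply: addC; apply: psi_gt; lra.
have psi0 : psi 0 = 0 by have := psiD 0 0; rewrite addr0; lra.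
have psiN v : psi (- v) = - psi v.
  by have := psiD v (- v); rewrite subrr psi0; lra.
(* One inequality suffices: the reverse one is the same at [- v]. *)
have psiZ_le (a : R) (v : X) : 0 < a -> a * psi v <= psi (a *: v).
  move=> a0; rewrite mulrC -ler_pdivlMr//; apply/ler_addgt0Pl => e e0.
  rewrite -lerBlDl ler_pdivlMr// mulrC; apply: psi_ge.
  by rewrite -scalerA -scalerBr; apply: scaleC => //; apply: psi_gt; lra.
have psiZ_gt0 (a : R) (v : X) : 0 < a -> psi (a *: v) = a * psi v.
  move=> a0; apply/eqP; rewrite eq_le psiZ_le// andbT.
  by have := psiZ_le a (- v) a0; rewrite scalerN !psiN mulrN lerN2.
have psiZ (a : R) (v : X) : psi (a *: v) = a * psi v.
  have [a0|a0|->] := ltgtP a 0; last by rewrite scale0r mul0r.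
  - by rewrite -[a]opprK scaleNr psiN psiZ_gt0 ?oppr_gt0 ?opprK// -mulNr opprK.
  - exact: psiZ_gt0.
have psi_linear : linear (psi : X -> R^o).
  by move=> a v w; rewrite psiD psiZ.
pose psiL : {linear X -> R^o} := HB.pack (psi : X -> R^o)
  (GRing.isLinear.Build R X R^o *:%R psi psi_linear).
exists psiL; split; last by move=> v Cv; apply: psi_ge; rewrite scale0r subr0.
apply/eqP; rewrite eq_le; apply/andP; split; apply/ler_addgt0Pl => e e0.
  by apply: psi_le; rewrite scalerDl scale1r addrK; exact: scaleC.
rewrite -lerBlDl; apply: psi_ge; rewrite scalerBl scale1r opprB addrC subrK.
exact: scaleC.
Qed.

(** * Continuity of convex functions bounded above near a point *)

Lemma cvg_affine (R : realType) (X : topologicalLmodType R) (a b : X) (t : R) :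
  (fun x => a + t *: (x - b)) @ b --> a.
Proof.
have : (fun x => a + t *: (x - b)) @ b --> a + t *: (b - b).
  apply: (@continuous_comp _ _ _ (fun y => (a, t *: (y - b)))
  (fun z : X * X => z.1 + z.2)); last exact: add_continuous.
  apply: cvg_pair; first exact: cvg_cst.
apply: (@continuous_comp X (R^o * X)%type X (fun y => (t, y - b))
  (fun z => z.1 *: z.2)); last exact: scale_continuous.
apply: (@cvg_pair _ _ _ _ (nbhs (t : R^o))); first exact: cvg_cst.
apply: (@continuous_comp _ _ _ (fun y => (y, b)) (fun z : X * X => z.1 - z.2));
  last exact: sub_continuous.
by apply: cvg_pair; [exact: cvg_id|exact: cvg_cst].
by rewrite subrr scaler0 addr0.
Qed.

Lemma convex_function_continuous (R : realType) (X : topologicalLmodType R)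
    (f : X -> R^o) (a : X) (M : R) :
  convex_function [set: X] f -> (\forall x \near a, f x <= M) -> continuous f.
Proof.
move=> cf fM x.
(* A bound near a propagates to x, the midpoint of a and 2x - a. *)
have [K] : exists K : R, \forall y \near x, f y <= K.
  exists (2^-1 * M + (1 - 2^-1) * f (x + (x - a))).
  have : \forall y \near x, f (a + 2 *: (y - x)) <= M.
    exact: (@cvg_affine _ _ a x 2 _ fM).
  apply: filterS => y fy.
  have -> : y = 2^-1 *: (a + 2 *: (y - x)) + (1 - 2^-1) *: (x + (x - a)).
    have -> : 1 - 2^-1 = 2^-1 :> R by lra.
    rewrite -scalerDr -[LHS](scalerK (a := 2))//; congr (_ *: _).
    rewrite [x + (x - a)]addrA -[x + x]mulr2n -[x *+ 2]scaler_nat.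
    by rewrite [_ - a]addrC addrACA subrr add0r -scalerDr subrK.
  apply: le_trans (convex_function_combination _ _ cf _) _; first lra.
  by apply: lerD => //; apply: ler_wpM2l => //; lra.
move=> fK; have fxK := nbhs_singleton fK.
apply/cvgrPdist_le => e e0.
(* Chosen so that [t <= 1] and [t * (K - f x) <= e], the error in both estimates below. *)
pose t := e / (K - f x + e + 1).
have K0 : 0 < K - f x + e + 1 by lra.
have t0 : 0 < t by exact: divr_gt0.
have t1 : t <= 1 by rewrite ler_pdivrMr//; lra.
have te : t * (K - f x) <= e.
  by rewrite mulrAC ler_pdivrMr// ler_pM2l//; lra.
have nearK (s : R) : \forall y \near x, f (x + s *: (y - x)) <= K.
  exact: (@cvg_affine _ _ x x s _ fK).
have tV : t * t^-1 = 1 by rewrite divff// gt_eqF.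
apply: filterS2 (nearK t^-1) (nearK (- t^-1)) => y fy1 fy2.
rewrite ler_norml; apply/andP; split.
  (* Upper estimate of [f y]: [y] lies between [x] and a point [t^-1] times as far from [x], where
     [f] is at most [K]. *)
  have yE : y = t *: (x + t^-1 *: (y - x)) + (1 - t) *: x.
    rewrite scalerDr scalerA tV scale1r scalerBl scale1r.
    by rewrite [x - _]addrC addrACA subrr add0r subrK.
  have := @convex_function_combination _ _ f t (x + t^-1 *: (y - x)) x cf.
  rewrite -yE => /(_ ltac:(lra)) fy.
  have := ler_wpM2l (ltW t0) fy1; lra.
(* Lower estimate of [f y]: [x] lies between [y] and the reflection in [x] of that far point, with
   weights [1 / (1 + t)] and [t / (1 + t)]. *)
have sE : 1 - (1 + t)^-1 = (1 + t)^-1 * t by field; lra.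
have xE : x = (1 + t)^-1 *: y + (1 - (1 + t)^-1) *: (x + - t^-1 *: (y - x)).
  rewrite sE -scalerA -scalerDr [t *: _]scalerDr [t *: (_ *: _)]scalerA.
  rewrite mulrN tV scaleN1r opprB.
  rewrite addrCA subrKC -[X in _ *: (_ + X)]scale1r -scalerDl addrC scalerK//.
  lra.
have s01 : 0 <= (1 + t)^-1 <= 1 by rewrite invr_ge0 invf_le1; lra.
have := @convex_function_combination _ _ f (1 + t)^-1
  y (x + - t^-1 *: (y - x)) cf.
rewrite -xE => /(_ s01) fx.
have {}fx : (1 + t) * f x <= f y + t * f (x + - t^-1 *: (y - x)).
  move: fx; rewrite sE -mulrA -mulrDr mulrC ler_pdivlMr; last lra.
  by rewrite mulrC.
have := ler_wpM2l (ltW t0) fy2; lra.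
Qed.

(** * Separation of a point from a convex set with interior *)

Lemma interior_segment (R : realType) (X : topologicalLmodType R) (D : set X)
    (d v : X) : interior D d -> exists2 e : R, 0 < e & D (d - e *: v).
Proof.
move=> Dd.
have cv : (fun e : R^o => d - e *: v) @ (0 : R^o) --> d.
  rewrite -[X in _ --> X]subr0 -[X in _ --> _ - X](scale0r v).
  apply: (@continuous_comp _ _ _ (fun e : R^o => (d, e *: v))
    (fun z : X * X => z.1 - z.2)); last exact: sub_continuous.
  apply: cvg_pair; first exact: cvg_cst.
  apply: (@continuous_comp R^o (R^o * X)%type X (fun e => (e, v))
    (fun z => z.1 *: z.2)); last exact: scale_continuous.
  by apply: (@cvg_pair _ _ _ _ (nbhs (0 : R^o)));
    [exact: cvg_id|exact: cvg_cst].
have /nbhs_ballP[e /= e0 De] := cv _ Dd.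
exists (e / 2); first exact: divr_gt0.
by apply: De; rewrite /ball /= sub0r normrN gtr0_norm ?divr_gt0//; lra.
Qed.

Lemma convex_set_separation (R : realType) (X : topologicalLmodType R)
    (D : set X) (d0 x0 : X) :
  convex_set D -> interior D d0 -> ~ D x0 ->
  exists psi : {linear X -> R^o}, [/\ continuous psi,
    (psi x0 : R) < psi d0 & forall d, D d -> (psi x0 : R) <= psi d].
Proof.
move=> cD iD nDx.
pose C0 : set X :=
  [set v | exists2 t : R, 0 < t & exists2 d, D d & v = t *: (d - x0)].
have bC0 : blunt_convex_cone C0.
  split=> [x y [t t0 [d Dd ->]] [s s0 [d' Dd' ->]]|a x a0 [t t0 [d Dd ->]]|].
  - have ts0 : 0 < t + s by exact: addr_gt0.
    (* The weights turn [t *: (d - x0) + s *: (d' - x0)] into a multiple of a single difference. *)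
    exists (t + s) => //; exists (t / (t + s) *: d + (1 - t / (t + s)) *: d').
      apply: convex_set_combination => //.
      by rewrite ler_pdivrMr// divr_ge0 ?ltW//=; lra.
    have -> : 1 - t / (t + s) = s / (t + s) by field; rewrite gt_eqF.
    rewrite [RHS]scalerBr [X in _ = X - _]scalerDr !scalerA !(mulrC (t + s)).
    by rewrite !divfK ?gt_eqF// scalerDl opprD addrACA !scalerBr.
  - exists (a * t); first exact: mulr_gt0.
    by exists d => //; rewrite scalerA.
  - move=> [t t0 [d Dd]] /esym/eqP; rewrite scaler_eq0 gt_eqF//= subr_eq0.
    by move=> /eqP dx; apply: nDx; rewrite -dx.
have [C [C0C bC totC]] := blunt_convex_cone_total bC0.
have CD d : D d -> C (d - x0).
  by move=> Dd; apply: C0C; exists 1 => //; exists d; rewrite ?scale1r.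
(* A point [d0 - e *: v] of [D] yields [e^-1 *: (d0 - x0) - v] in the cone, so [d0 - x0] is an order
   unit. *)
have unitC v : exists r : R, C (r *: (d0 - x0) - v).
  have [e e0 De] := interior_segment v iD.
  exists e^-1; apply: C0C; exists e^-1; first by rewrite invr_gt0.
  exists (d0 - e *: v) => //.
  by rewrite addrAC [RHS]scalerBr scalerA mulVf ?scale1r// gt_eqF.
have [psi [psi1 psi_ge0]] :=
  total_cone_functional bC totC (CD _ (interior_subset iD)) unitC.
have psiD d : D d -> (psi x0 : R) <= psi d.
  by move=> /CD/psi_ge0; rewrite linearB subr_ge0.
exists psi; split => //; last by rewrite -subr_gt0 -linearB psi1.
(* Continuity of [psi]: [- psi] is convex and at most [- psi x0] on [D], a neighbourhood of [d0]. *)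
pose f : X -> R^o := fun x => - psi x.
have cf : continuous f.
  apply: (@convex_function_continuous _ _ f d0 (- psi x0)).
    by move=> t x y _ _; rewrite /f linearD !linearZ /= opprD -!mulrN.
  by apply: filterS iD => d /psiD; rewrite /f lerN2.
move=> x; have -> : (psi : X -> R^o) = - f.
  by apply/funext => y; rewrite /f /= opprK.
exact: cvgN (cf x).
Qed.

(** * Bounds and convexity of risk measures *)

Section risk_measure.
Context (R : realType) (X : lmodType R) (A : set X) (S : R * X).

Lemma risk_measure_le (x : X) (m : R) :
  A (x + (m / S.1) *: S.2) -> (risk_measure A S x <= m%:E)%E.
Proof. by move=> Am; apply: ereal_inf_lbound; exists m. Qed.

Lemma risk_measure_lt (x : X) (y : \bar R) : (risk_measure A S x < y)%E ->
  exists2 m : R, A (x + (m / S.1) *: S.2) & (m%:E < y)%E.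
Proof. by move=> /ereal_inf_lt[_ [m Am <-]] my; exists m. Qed.

Lemma risk_measure_convex : convex_set A ->
  finitely_valued (risk_measure A S) ->
  convex_function [set: X] (fun x => fine (risk_measure A S x) : R^o).
Proof.
move=> cA fin t x y _ _; apply/ler_addgt0Pl => e e0.
(* The infimum need not be attained, so [e]-optimal amounts are combined instead. *)
have approx z : exists2 m, A (z + (m / S.1) *: S.2) &
    m < fine (risk_measure A S z) + e.
  have [|m Am] := @risk_measure_lt z (fine (risk_measure A S z) + e)%:E.
    by rewrite EFinD fineK// lteDl// lte_fin.
  by rewrite lte_fin; exists m.
have [m Am mx] := approx x; have [n An ny] := approx y.
have t01 : 0 <= t%:num <= 1 by apply/andP; split.
pose k := t%:num * m + (1 - t%:num) * n.
have /risk_measure_le :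
    A ((t%:num *: x + (1 - t%:num) *: y) + (k / S.1) *: S.2).
  have := convex_set_combination cA t01 Am An.
  rewrite !scalerDr addrACA !scalerA -scalerDl !mulrA -mulrDl.
  exact.
rewrite -(fineK (fin _)) lee_fin => /le_trans; apply.
move/andP : t01 => [t0 t1].
change (k <= e + (t%:num * fine (risk_measure A S x) +
  (1 - t%:num) * fine (risk_measure A S y))).
rewrite /k; have := ler_wpM2l t0 (ltW mx).
have t1' : 0 <= 1 - t%:num by rewrite subr_ge0.
have := ler_wpM2l t1' (ltW ny); lra.
Qed.

End risk_measure.

(** * Finiteness criterion and continuity *)

Theorem theorem3p12 (R : realType) (X : topologicalLmodType R) (P : set X)
    (hX : ordered_tvs P) (U : X) (hU : strictly_positive P U)
    (A : set X) (hA : acceptance_set P A) (hAconv : convex_set A)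
    (hAint : interior A !=set0)
    (S : R * X) (hS : traded_asset P S)
    (hrho : forall x : X, risk_measure A S x <> -oo%E) :
  (finitely_valued (risk_measure A S) <->
     forall lambda : R, 0 < lambda ->
       (risk_measure A S (- (lambda *: U)) < +oo)%E) /\
  (finitely_valued (risk_measure A S) -> continuous (risk_measure A S)).
Proof.
have [a iA] := hAint; split; first split.
- by move=> fin l _; rewrite ltey_eq fin.
- move=> hl x; rewrite fin_numE; apply/andP; split; first exact/eqP/hrho.
  have [S0 _ _] := hS.
  pose D := [set x | exists m : R, A (x + m *: S.2)].
  have DP z : D z <-> (risk_measure A S z < +oo)%E.
    split=> [[m Am]|/risk_measure_lt[m Am _]]; last by exists (m / S.1).
    apply: (@le_lt_trans _ _ (m * S.1)%:E); last exact: ltry.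
    by apply: risk_measure_le; rewrite mulfK// gt_eqF.
  rewrite -ltey; apply/DP; apply: contrapT => nDx.
  have AD : A `<=` D by move=> z Az; exists 0; rewrite scale0r addr0.
  have cD : convex_set D.
    move=> y z t /set_mem[m Am] /set_mem[n An]; apply/mem_set.
    exists (t%:num * m + (1 - t%:num) * n).
    have := convex_set_combination (t := t%:num) hAconv _ Am An.
    rewrite !scalerDr addrACA !scalerA -scalerDl; apply.
    by apply/andP; split.
  have [psi [cpsi psix psiD]] := convex_set_separation cD (interiorS AD iA) nDx.
  have [_ [[_ _ coneP] _]] := hX.
  have [_ _ monA] := hA; have [_ psiU] := hU.
  have psiP p : P p -> 0 <= (psi p : R).
    move=> Pp; rewrite leNgt; apply/negP => psip.
    (* At this [t], [psi (a + t *: p) = psi x]; one further [p] goes strictly below [psi x] while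
       staying in [A] by monotonicity. *)
    pose t := (psi a - psi x) / - psi p : R.
    have t0 : 0 <= t 
      by apply: divr_ge0; rewrite ?subr_ge0 ?oppr_ge0; exact: ltW.
    have /AD/psiD : A (a + (t + 1) *: p).
      apply: (monA _ _ (interior_subset iA)); rewrite /cone_le addrC addKr.
      by apply: coneP => //; rewrite addr_ge0.
    rewrite linearD linearZ /= -[X in X <= _]subr0 => h.
    have tE : t * psi p = psi x - psi a.
      by rewrite /t; field; rewrite lt_eqF.
    have : (psi x : R) <= psi a + (t + 1) * psi p by move: h; rewrite subr0.
    by rewrite mulrDl tE; lra.
  have {}psiU : 0 < (psi U : R).
    apply: psiU; first by split.
    by move=> psi0; move: psix; rewrite !psi0 ltxx.
  (* Makes [psi (- (l *: U)) = - |psi x| - 1], which is below [psi x]. *)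
  pose l := (`|psi x : R| + 1) / psi U.
  have l0 : 0 < l by apply: divr_gt0 => //; rewrite ltr_wpDl.
  have /DP/psiD := hl l l0.
  rewrite linearN linearZ /=.
  have -> : l *: psi U = `|psi x : R| + 1 :> R.
    by rewrite /l /GRing.scale /= divfK// gt_eqF.
  have : - `|psi x : R| <= psi x by rewrite lerNl -normrN ler_norm.
  lra.
- move=> fin x.
  have -> : risk_measure A S = EFin \o (fun y => fine (risk_measure A S y)).
    by apply/funext => y /=; rewrite fineK.
  apply: cvg_EFin; first exact: nearW.
  (* The bound 0 holds on [A], where no capital has to be added. *)
  apply: (convex_function_continuous (risk_measure_convex hAconv fin)
    (a := a) (M := 0)).
  apply: filterS iA => z Az; rewrite -lee_fin fineK//.
  by apply: risk_measure_le; rewrite mul0r scale0r addr0.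
Qed.
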